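(* Let $K$ be a field of positive characteristic $p>0$, let $R$ be either $K[z]=K[z_1,\dots,z_n]$ or $K(z)=K(z_1,\dots,z_n)$, and let $r\ge 0$. An $r$-form $\omega\in\Omega^r_{R/K}$ is exact if and only if $\omega$ is $p$-closed.
   Context: $\Omega^r_{R/K}$ is the $R$-module of algebraic (Kähler) differential $r$-forms of $R$ over $K$; it is free with basis $dz_I=dz_{i_1}\wedge\cdots\wedge dz_{i_r}$, $I=(i_1<\cdots<i_r)$, $1\le i_k\le n$. $d$ is the exterior derivative and $\partial_i=\partial/\partial z_i$. $\omega$ is closed if $d\omega=0$. For $r\ge 1$, $\omega\in\Omega^r_{R/K}$ is exact if $\omega=d\eta$ for some $\eta\in\Omega^{r-1}_{R/K}$; for $r=0$, exactness is understood with respect to the sequence $0\to K\hookrightarrow R\xrightarrow{d}\Omega^1_{R/K}\xrightarrow{d}\cdots$, i.e. $\omega\in R$ is exact if $\omega\in K$. Definition ($p$-closed): for $r\ge1$, an $r$-form $\omega=\sum_I a_I\,dz_I\in\Omega^r_{R/K}$ is $p$-closed if $d\omega=0$ and, for every multi-index $I=(i_1<\cdots<i_r)$, $\partial_I^{p-1}(a_I):=\partial_{i_1}^{p-1}\cdots\partial_{i_r}^{p-1}(a_I)=0$. For $r=0$, $\omega\in R$ is $p$-closed if $\omega\in K$. *)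

(* Defs.v *)
From HB Require Import structures.
From mathcomp Require Import all_boot all_order all_algebra.
From mathcomp Require Import ring.
From mathcomp Require Export mpoly.

Set Implicit Arguments.
Unset Strict Implicit.
Unset Printing Implicit Defensive.

Import GRing.Theory.
Local Open Scope ring_scope.

(* Omega^r_{R/K} in coordinates: R is a commutative ring over K via iota,     *)
(* pd i = d/dz_i (i < n), the multi-index i_1 < ... < i_r is the r-element    *)
(* subset {i_1, ..., i_r} of 'I_n, and an r-form is the family of its         *)
(* coefficients on the basis dz_I.  That Omega^1 is the module of Kaehler     *)
(* differentials of K[z] and K(z) is the content of kaehler_mpoly and         *)
(* kaehler_ratfun: a K-derivation D of R into any R-module satisfies          *)
(* D f = \sum_i (d f / d z_i) D z_i, so f |-> \sum_i (d f / d z_i) dz_i is    *)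
(* the universal one; Omega^r is its r-th exterior power.                     *)

Definition mindex (n r : nat) := {I : {set 'I_n} | #|I| == r}.

Definition dform (n : nat) (R : comNzRingType) (r : nat) :=
  {ffun mindex n r -> R^o}.

Section Forms.
Variables (n : nat) (K R : comNzRingType).
Variables (iota : K -> R) (pd : 'I_n -> R -> R).

Definition dz r (I : mindex n r) : dform n R r := [ffun J => (J == I)%:R].

(* dz_i /\ dz_I: zero if i \in I, and otherwise dz_(i |: I) with the sign     *)
(* that moves i past the smaller elements of I.                               *)
Definition dz_wedge r (i : 'I_n) (I : mindex n r) : dform n R r.+1 :=
  [ffun J : mindex n r.+1 =>
     if (i \notin val I) && (val J == i |: val I)
     then (-1) ^+ #|[set j in val I | (j < i)%N]| else 0].

(* d (\sum_I a_I dz_I) = \sum_I \sum_i (d a_I / d z_i) dz_i /\ dz_I *)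
Definition ext_d r (w : dform n R r) : dform n R r.+1 :=
  \sum_(I : mindex n r) \sum_(i < n) pd i (w I) *: dz_wedge i I.

Definition is_const (w : dform n R 0) : Prop :=
  exists c : K, w = [ffun => iota c].

Definition exact_form r : dform n R r -> Prop :=
  match r with
  | 0 => is_const
  | r'.+1 => fun w => exists eta : dform n R r', w = ext_d eta
  end.

(* enum I lists I increasingly, so this is                                    *)
(* pd_(i_1)^(p-1) ( ... (pd_(i_r)^(p-1) a)).                                  *)
Definition pd_pow (p : nat) (I : {set 'I_n}) (a : R) : R :=
  foldr (fun i => iter p.-1 (pd i)) a (enum I).

Definition p_closed (p r : nat) : dform n R r -> Prop :=
  match r with
  | 0 => is_const
  | r'.+1 => fun w => ext_d w = 0 /\
      forall I : mindex n r'.+1, pd_pow p (val I) (w I) = 0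
  end.

Lemma dform_dz r (w : dform n R r) : w = \sum_I w I *: dz I.
Proof.
apply/ffunP=> J; rewrite sum_ffunE (bigD1 J) //= big1 ?addr0.
  by rewrite !ffunE eqxx /GRing.scale /= mulr1.
by move=> I neIJ; rewrite !ffunE eq_sym (negPf neIJ) scaler0.
Qed.

End Forms.

Definition is_Kderivation (K R : comNzRingType) (iota : K -> R)
    (M : lmodType R) (D : R -> M) : Prop :=
  [/\ forall f g, D (f + g) = D f + D g,
      forall f g, D (f * g) = g *: D f + f *: D g
    & forall c, D (iota c) = 0].

Notation ratfun n K := {fraction {mpoly K[n]}}.

Definition ratfunC (n : nat) (K : fieldType) (c : K) : ratfun n K :=
  tofrac c%:MP_[n].

(* Quotient rule on the chosen representative; fderivE shows that the choice  *)
(* is irrelevant.                                                             *)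
Definition fderiv (n : nat) (K : fieldType) (i : 'I_n) (f : ratfun n K) :
    ratfun n K :=
  let a := \n_(repr f) in let b := \d_(repr f) in
  tofrac (mderiv i a * b - a * mderiv i b) / tofrac (b ^+ 2).

Section Coordinates.
Variables (n : nat) (K : fieldType).
Local Notation P := {mpoly K[n]}.
Local Notation F := (ratfun n K).

Lemma ratfun_repr (f : F) :
  f = tofrac \n_(repr f) / tofrac \d_(repr f).
Proof.
have d0 : tofrac \d_(repr f) != 0 :> F by rewrite tofrac_eq0 denom_ratioP.
have mulE (x : {ratio P}) :
    FracField.mul (\pi_F x)%qT (tofrac \d_x) = tofrac \n_x.
  apply/eqP; rewrite !piE FracField.equivfE /FracField.mulf.
  rewrite !numden_Ratio ?mulf_neq0 ?denom_ratioP ?oner_eq0 //.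
  by rewrite !mulr1 mulrC.
by apply: (canRL (mulfK d0)); rewrite -[RHS]mulE reprK.
Qed.

Lemma fderivE (i : 'I_n) (a b : P) : b != 0 ->
  fderiv i (tofrac a / tofrac b) =
  tofrac (mderiv i a * b - a * mderiv i b) / tofrac (b ^+ 2).
Proof.
move=> b0; rewrite /fderiv; set f := tofrac a / tofrac b.
have := ratfun_repr f; set c := \n_(repr f); set e := \d_(repr f).
have e0 : e != 0 := denom_ratioP _.
move/eqP; rewrite /f eqr_div ?tofrac_eq0 // -!tofracM tofrac_eq => /eqP ae.
apply/eqP; rewrite eqr_div ?tofrac_eq0 ?expf_neq0 // -!tofracM tofrac_eq.
have := congr1 (mderiv i) ae; rewrite !mderivM => Dae.
apply/eqP; move: ae Dae.
move: (mderiv i a) (mderiv i b) (mderiv i c) (mderiv i e) => a' b' c' e' ae Dae.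
transitivity (b * e * (b * c' + b' * c - b' * c) - b ^+ 2 * c * e'); first by ring.
have -> : b * c' + b' * c = a' * e + a * e' by rewrite Dae; ring.
transitivity (b * e * (a' * e + a * e' - b' * c) - b * e' * (c * b)); first by ring.
rewrite -ae.
transitivity (b * e ^+ 2 * a' - e * b' * (c * b)); first by ring.
by rewrite -ae; ring.
Qed.

Lemma fderiv_tofrac (i : 'I_n) (a : P) :
  fderiv i (tofrac a) = tofrac (mderiv i a).
Proof.
have {1}-> : tofrac a = tofrac a / tofrac 1 by rewrite tofrac1 divr1.
rewrite fderivE ?oner_eq0 // -mpolyC1 mderivC mpolyC1.
by rewrite mulr0 subr0 mulr1 expr1n tofrac1 divr1.
Qed.

Lemma mderivXi (i j : 'I_n) : mderiv i ('X_j : P) = (j == i)%:R.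
Proof.
rewrite mderivX mnm1E; case: eqP => [->|_]; last by rewrite scale0r.
by rewrite -[X in (X - _)%MM]add0m addmK mpolyX0 scale1r.
Qed.

Lemma mderiv_Kderivation (i : 'I_n) :
  is_Kderivation (@mpolyC n K) (mderiv i : P -> P^o).
Proof.
split=> [f g|f g|c]; [exact: mderivD | | exact: mderivC].
by rewrite mderivM mulrC.
Qed.

Lemma fderiv_Kderivation (i : 'I_n) :
  is_Kderivation (@ratfunC n K) (fderiv i : F -> F^o).
Proof.
split=> [f g|f g|c].
- rewrite (ratfun_repr f) (ratfun_repr g).
  move: (denom_ratioP (repr f)) (denom_ratioP (repr g)).
  move: \n_(repr f) \d_(repr f) \n_(repr g) \d_(repr g) => a b c e b0 e0.
  rewrite addf_div ?tofrac_eq0 // -!tofracM -tofracD !fderivE ?mulf_neq0 //.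
  rewrite addf_div ?tofrac_eq0 ?expf_neq0 // -!tofracM -tofracD.
  apply/eqP; rewrite eqr_div ?tofrac_eq0 ?expf_neq0 ?mulf_neq0 ?expf_neq0 //.
  rewrite -!tofracM tofrac_eq; apply/eqP; rewrite mderivD !mderivM; ring.
- rewrite /GRing.scale /= (ratfun_repr f) (ratfun_repr g).
  move: (denom_ratioP (repr f)) (denom_ratioP (repr g)).
  move: \n_(repr f) \d_(repr f) \n_(repr g) \d_(repr g) => a b c e b0 e0.
  rewrite mulf_div -!tofracM !fderivE ?mulf_neq0 // !mulf_div -!tofracM.
  rewrite addf_div ?tofrac_eq0 ?mulf_neq0 ?expf_neq0 // -!tofracM -tofracD.
  apply/eqP; rewrite eqr_div ?tofrac_eq0 ?expf_neq0 ?mulf_neq0 ?expf_neq0 //.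
  rewrite -!tofracM tofrac_eq; apply/eqP; rewrite !mderivM; ring.
- by rewrite /ratfunC fderiv_tofrac mderivC tofrac0.
Qed.

Lemma mpoly_generated (Q : P -> Prop) :
  (forall c, Q c%:MP) -> (forall i, Q 'X_i) ->
  (forall f g, Q f -> Q g -> Q (f + g)) ->
  (forall f g, Q f -> Q g -> Q (f * g)) -> forall f, Q f.
Proof.
move=> QC QX QD QM; elim/mpolyind=> [|c m f _ _ Qf]; first exact: (QC 0).
apply: (QD) => //; rewrite -mul_mpolyC; apply: (QM) => //.
rewrite mpolyXE_id; elim/big_rec: _ => [|i g _ Qg]; first exact: (QC 1).
apply: (QM) => //; elim: (m i) => [|k IH]; first exact: (QC 1).
by rewrite exprS; apply: QM.
Qed.

Lemma kaehler_mpoly (M : lmodType P) (D : P -> M) :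
  is_Kderivation (@mpolyC n K) D ->
  forall f, D f = \sum_(i < n) mderiv i f *: D 'X_i.
Proof.
case=> DD DM DC; apply: mpoly_generated => [c|j|f g Df Dg|f g Df Dg].
- by rewrite DC big1 // => i _; rewrite mderivC scale0r.
- rewrite (bigD1 j) //= big1 ?addr0 => [|i neij].
    by rewrite mderivXi eqxx scale1r.
  by rewrite mderivXi eq_sym (negPf neij) scale0r.
- by rewrite DD Df Dg -big_split; apply: eq_bigr => i _; rewrite mderivD scalerDl.
- rewrite DM Df Dg !scaler_sumr -big_split; apply: eq_bigr => i _ /=.
  by rewrite mderivM scalerDl !scalerA mulrC.
Qed.

Lemma kaehler_ratfun (M : lmodType F) (D : F -> M) :
  is_Kderivation (@ratfunC n K) D ->
  forall f, D f = \sum_(i < n) fderiv i f *: D (tofrac ('X_i : P)).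
Proof.
move=> [DD DM DC].
pose E f := \sum_(i < n) fderiv i f *: D (tofrac ('X_i : P)).
have ED f g : E (f + g) = E f + E g.
  rewrite /E -big_split; apply: eq_bigr => i _.
  by have [-> _ _] := fderiv_Kderivation i; rewrite scalerDl.
have EM f g : E (f * g) = g *: E f + f *: E g.
  rewrite /E !scaler_sumr -big_split; apply: eq_bigr => i _ /=.
  have [_ -> _] := fderiv_Kderivation i; rewrite scalerDl.
  by congr (_ + _); exact/esym/scalerA.
have DEP (a : P) : D (tofrac a) = E (tofrac a).
  move: a; apply: mpoly_generated => [c|j|f g Df Dg|f g Df Dg].
  - rewrite DC /E big1 // => i _.
    by have [_ _ ->] := fderiv_Kderivation i; rewrite scale0r.
  - have fX i : fderiv i (tofrac ('X_j : P)) = (j == i)%:R.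
      transitivity (tofrac (mderiv i ('X_j : P)) : F).
        exact: fderiv_tofrac.
      by rewrite mderivXi; case: eqP; rewrite ?tofrac1 ?tofrac0.
    rewrite /E (bigD1 j) //= fX eqxx scale1r big1 ?addr0 // => i neij.
    by rewrite fX eq_sym (negPf neij) scale0r.
  - by rewrite tofracD DD ED Df Dg.
  - by rewrite tofracM DM EM Df Dg.
move=> f; rewrite -/(E f).
have b0 : tofrac \d_(repr f) != 0 :> F by rewrite tofrac_eq0 denom_ratioP.
have /eqP := DEP \n_(repr f).
have -> : tofrac \n_(repr f) = f * tofrac \d_(repr f).
  by rewrite {2}(ratfun_repr f) divfK.
by rewrite DM EM DEP => /eqP/addIr/(scalerI b0).
Qed.

End Coordinates.

(* Main.v *)
From HB Require Import structures.
Require Import Defs.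
From mathcomp Require Import all_boot all_order all_algebra ring.

(**
  Over a ring with commuting derivations d_i dual to coordinates z_i, let
  T_i f = \sum_(k < p - 1) (-1)^k z_i^(k+1) / (k+1)! d_i^k f, the truncated
  Taylor antiderivative: d_i T_i f telescopes to
  f - (-1)^(p-1) z_i^(p-1) / (p-1)! d_i^(p-1) f, and T_i commutes with d_j for
  j != i.  Composing T_i with the contraction by d/dz_i gives H_i with
  d H_i + H_i d = 1 - Phi_i, where Phi_i acts on the coefficient of dz_I by
  1 - d_i T_i if i \in I and by 1 - T_i d_i otherwise.  Applying all the Phi_i
  in turn leaves a closed form unchanged modulo exact forms; on the coefficient
  a_I the result factors through d_I^(p-1) a_I, hence is zero for a p-closed
  form.  The converse follows from d_i^p = 0.
*)

Set Implicit Arguments.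
Unset Strict Implicit.
Unset Printing Implicit Defensive.

Import GRing.Theory.
Local Open Scope ring_scope.

(** * Signs and the exterior derivative on forms of all degrees *)

Section DeRham.
Variables (n : nat) (R : comNzRingType).
Variables (d : 'I_n -> {additive R -> R}).

(* Forms of all degrees at once: the coefficient family is indexed by every
   subset of 'I_n, which avoids dependent types. *)
Definition form := {ffun {set 'I_n} -> R}.

Definition sgn (j : 'I_n) (A : {set 'I_n}) : R :=
  (-1) ^+ #|[set k in A | (k < j)%N]|.

Definition dR (g : form) : form :=
  [ffun A : {set 'I_n} => \sum_(j in A) sgn j A * d j (g (A :\ j))].

Lemma sgn_sqr j A : sgn j A * sgn j A = 1.
Proof. by rewrite -expr2 sqrr_sign. Qed.

Lemma sgn_setD1 (j k : 'I_n) (A : {set 'I_n}) :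
  k \in A -> sgn j A = (if (k < j)%N then -1 else 1) * sgn j (A :\ k).
Proof.
move=> kA; rewrite /sgn (cardsD1 k) inE kA /=.
have -> : [set i in A | (i < j)%N] :\ k = [set i in A :\ k | (i < j)%N].
  by apply/setP => i; rewrite !inE andbA.
by case: ifP; rewrite ?exprS ?mul1r.
Qed.

Lemma sgn_id j A : sgn j (A :\ j) = sgn j A.
Proof.
congr (_ ^+ _); apply: eq_card => k; rewrite !inE.
by case: eqP => [->|]; rewrite ?ltnn ?andbF.
Qed.

(** Exactly one of [k < j] and [j < k] holds, so removing the other index flips exactly one of the
    two signs. *)
Lemma sgn_swap (j k : 'I_n) (A : {set 'I_n}) : j != k -> j \in A -> k \in A ->
  sgn j A * sgn k A = - (sgn j (A :\ k) * sgn k (A :\ j)).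
Proof.
move=> neq_jk jA kA; rewrite (sgn_setD1 j kA) (sgn_setD1 k jA).
case: (ltngtP k j) => [_|_|/val_inj eq_kj]; last by rewrite eq_kj eqxx in neq_jk.
  by rewrite !mul1r !mulN1r mulNr.
by rewrite !mul1r !mulN1r mulrN.
Qed.

(** The anticommutation of dz_j and dz_k, which makes d d = 0. *)
Lemma sgn_setD1_swap (j k : 'I_n) (A : {set 'I_n}) : j != k -> j \in A -> k \in A ->
  sgn j A * sgn k (A :\ j) = - (sgn k A * sgn j (A :\ k)).
Proof.
move=> neq_jk jA kA; rewrite (sgn_setD1 j kA) (sgn_setD1 k jA).
case: (ltngtP k j) => [_|_|/val_inj eq_kj]; last by rewrite eq_kj eqxx in neq_jk.
  by rewrite !mul1r !mulN1r mulNr mulrC.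
by rewrite !mul1r !mulN1r mulNr opprK mulrC.
Qed.

Lemma signM_additive (f : {additive R -> R}) j A x :
  f (sgn j A * x) = sgn j A * f x.
Proof. by rewrite /sgn -signr_odd !mulr_sign; case: odd; rewrite ?raddfN. Qed.

Fact dR_is_additive : zmod_morphism dR.
Proof.
move=> g h; apply/ffunP => A; rewrite !ffunE -sumrB; apply: eq_bigr => j _.
by rewrite !ffunE raddfB mulrBr.
Qed.
HB.instance Definition _ :=
  GRing.isZmodMorphism.Build form form dR dR_is_additive.

Hypothesis d_comm : forall i j f, d i (d j f) = d j (d i f).

Lemma dR_dR g : dR (dR g) = 0.
Proof.
apply/ffunP => A; rewrite !ffunE.
pose t j k := sgn j A * (sgn k (A :\ j) * d j (d k (g (A :\ j :\ k)))).
have -> : \sum_(j in A) sgn j A * d j (dR g (A :\ j)) =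
    \sum_(j in A) \sum_(k in A | k != j) t j k.
  apply: eq_bigr => j _; rewrite ffunE raddf_sum mulr_sumr.
  apply: eq_big => [k|k _]; first by rewrite !inE andbC.
  by rewrite signM_additive.
have tN j k : j \in A -> k \in A -> k != j -> t j k = - t k j.
  move=> jA kA neq; rewrite /t !mulrA sgn_setD1_swap 1?eq_sym // mulNr.
  by rewrite d_comm setDDl setUC -setDDl.
(* Terms with [k < j] are matched with terms with [j < k]: showing only that the sum is its own
   negative would not suffice in characteristic 2. *)
under eq_bigr => j _ do rewrite (bigID (fun k : 'I_n => (k < j)%N)) /=.
rewrite big_split /= [X in X + _](exchange_big_dep (mem A)) //=; last first.
  by move=> j k _ /andP[/andP[]].
rewrite -big_split big1 //= => j jA.
apply/eqP; rewrite addr_eq0 -sumrN; apply/eqP; apply: eq_big => k.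
  rewrite jA /= -!val_eqE /=.
  by case: (ltngtP j k); rewrite ?andbF ?andbT.
move=> /andP[kA /andP[/andP[_ neq] _]].
by rewrite tN // eq_sym.
Qed.

(** * The homotopy in one coordinate direction *)

Section Homotopy.
Variables (i : 'I_n) (T : {additive R -> R}).
Hypothesis Td : forall j f, j != i -> T (d j f) = d j (T f).

Definition htpy (g : form) : form :=
  [ffun A : {set 'I_n} => if i \in A then 0 else sgn i A * T (g (i |: A))].

(** The operator Phi_i on the coefficient of dz_A. *)
Definition htpy_defect (A : {set 'I_n}) (a : R) : R :=
  if i \in A then a - d i (T a) else a - T (d i a).

Lemma htpyP g :
  dR (htpy g) + htpy (dR g) = g - [ffun A => htpy_defect A (g A)].
Proof.
apply/ffunP => A; rewrite !ffunE /htpy_defect; case: ifPn => iA.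
  (* In [dR (htpy g)] only [j = i] survives, since for other [j] the set [A :\ j] still contains
     [i]. *)
  rewrite addr0 opprB addrCA subrr addr0 (bigD1 i) //= big1 ?addr0.
    by rewrite ffunE !inE eqxx sgn_id /= setD1K // signM_additive mulrA sgn_sqr mul1r.
  move=> j /andP[jA neq]; rewrite ffunE !inE eq_sym neq iA /=.
  by rewrite raddf0 mulr0.
(* The term [j = i] of [dR g] gives [T (d i (g A))]; each term with [j] in [A] cancels the
   corresponding term of [dR (htpy g)], by [Td] and opposite signs. *)
rewrite opprB addrCA subrr addr0 (big_setU1 _ iA) /= raddfD mulrDr.
have sgnU : sgn i (i |: A) = sgn i A by rewrite -sgn_id setU1K.
rewrite signM_additive setU1K // sgnU mulrA sgn_sqr mul1r addrCA.
rewrite raddf_sum mulr_sumr -big_split big1 /= ?addr0 // => j jA.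
have neq : j != i by apply: contraNneq iA => <-.
rewrite ffunE !inE eq_sym (negPf neq) (negPf iA) ?andbF /= !signM_additive.
have -> : i |: A :\ j = (i |: A) :\ j.
  by apply/setP => k; rewrite !inE; case: (k =P i) => [->|//]; rewrite eq_sym neq.
rewrite Td // !mulrA -mulrDl.
suff -> : sgn i A * sgn j (i |: A) = - (sgn j A * sgn i (A :\ j)).
  by rewrite subrr mul0r.
have neq' : i != j by rewrite eq_sym.
rewrite -sgnU (sgn_swap neq' (setU11 i A) (setU1r i jA)) setU1K // mulrC.
by rewrite -(sgn_id i (_ :\ j)) setDDl (setUC [set j]) -setDDl setU1K.
Qed.
End Homotopy.

(** * The truncated Taylor antiderivative in characteristic p *)

Variables (p : nat) (z : 'I_n -> R).
Hypothesis hp : p \in [pchar R].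
Hypothesis dM : forall i f g, d i (f * g) = d i f * g + f * d i g.
Hypothesis dX : forall i j, d i (z j) = (j == i)%:R.
Hypothesis d_p : forall i f, iter p (d i) f = 0.

Lemma iterd_is_additive k i : zmod_morphism (iter k (d i)).
Proof. by move=> f g; elim: k => //= k ->; rewrite raddfB. Qed.
HB.instance Definition _ k i :=
  GRing.isZmodMorphism.Build R R (iter k (d i)) (iterd_is_additive k i).

Lemma d_natr i k : d i k%:R = 0.
Proof.
suff d1 : d i 1 = 0 by rewrite raddfMn d1 mul0rn.
by have /eqP := dM i 1 1; rewrite !mulr1 mul1r -subr_eq subrr eq_sym => /eqP.
Qed.

Lemma d_sign i k : d i ((-1) ^+ k) = 0.
Proof. by rewrite -signr_odd; case: odd; rewrite ?raddfN ?(d_natr i 1) ?oppr0. Qed.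

Lemma dXn i k f :
  d i (z i ^+ k.+1 * f) = k.+1%:R * z i ^+ k * f + z i ^+ k.+1 * d i f.
Proof.
rewrite dM; congr (_ * _ + _); elim: k => [|k IH].
  by rewrite expr1 expr0 dX eqxx mulr1.
rewrite exprS dM dX eqxx IH mul1r mulrCA -exprS -[k.+2]add1n natrD mulrDl.
by rewrite mul1r.
Qed.

Lemma dXn_neq i j k f : j != i -> d j (z i ^+ k * f) = z i ^+ k * d j f.
Proof.
move=> neq; rewrite dM [X in X * f](_ : _ = 0) ?mul0r ?add0r //.
elim: k => [|k IH]; first exact: (d_natr j 1).
by rewrite exprS dM dX eq_sym (negPf neq) IH mul0r mulr0 addr0.
Qed.

Let p_gt1 : (1 < p)%N := prime_gt1 (pcharf_prime hp).

(* By Wilson's theorem this is 1 / k`! in characteristic p, for k < p; it makes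
   sense in R although k`! need not be known to be a unit there. *)
Definition invfact k : R := - (p.-1 ^_ (p.-1 - k))%:R.

Lemma invfact0 : invfact 0 = 1.
Proof.
rewrite /invfact subn0 ffactnn; apply/esym/eqP; rewrite -addr_eq0.
rewrite addrC natr1 -(dvdn_pcharf hp).
by rewrite -Wilson ?(pcharf_prime hp).
Qed.

Lemma invfactS k : (k < p.-1)%N -> k.+1%:R * invfact k.+1 = invfact k.
Proof.
move=> lt_kp; rewrite /invfact mulrN -natrM -(subnSK lt_kp) ffactnSr.
by rewrite subKn // mulnC.
Qed.

Definition prim i (f : R) : R :=
  \sum_(k < p.-1)
    (-1) ^+ k * (invfact k.+1 * (z i ^+ k.+1 * iter k (d i) f)).

Fact prim_is_additive i : zmod_morphism (prim i).
Proof.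
move=> f g; rewrite -sumrB; apply: eq_bigr => k _.
by rewrite raddfB -!mulrBr.
Qed.
HB.instance Definition _ i :=
  GRing.isZmodMorphism.Build R R (prim i) (prim_is_additive i).

Lemma iterd_comm k i j f : iter k (d i) (d j f) = d j (iter k (d i) f).
Proof. by elim: k => //= k ->; rewrite d_comm. Qed.

Lemma prim_comm i j f : j != i -> prim i (d j f) = d j (prim i f).
Proof.
move=> neq; rewrite raddf_sum; apply: eq_bigr => k _; rewrite iterd_comm.
rewrite dM d_sign mul0r add0r; congr (_ * _).
rewrite dM raddfN d_natr oppr0 mul0r add0r; congr (_ * _).
by rewrite dXn_neq.
Qed.

(** The Taylor term of order p - 1, at which the telescoping stops; it has d_i^(p-1) f as a
    factor. *)
Definition top_part i (f : R) : R :=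
  (-1) ^+ p.-1 * invfact p.-1 * (z i ^+ p.-1 * iter p.-1 (d i) f).

Lemma d_prim i f : d i (prim i f) = f - top_part i f.
Proof.
(* [d i] sends the k-th summand of [prim i f] to [v k - v k.+1]. *)
pose v k := (-1) ^+ k * (invfact k * (z i ^+ k * iter k (d i) f)).
have v0 : v 0 = f by rewrite /v !expr0 invfact0 !mul1r.
rewrite /top_part -mulrA -/(v _) -[X in X - v _]v0 raddf_sum /=.
rewrite -[RHS]opprB -[v p.-1 - _]telescope_sumr // big_mkord -sumrN; apply: eq_bigr => k _.
rewrite dM d_sign mul0r add0r dM raddfN d_natr oppr0 mul0r add0r dXn.
rewrite /v -(invfactS (ltn_ord k)) iterS [(-1) ^+ k.+1]exprS.
by move: ((-1) ^+ k) => e; ring.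
Qed.

Lemma top_part_comm i j f : j != i -> top_part i (d j f) = d j (top_part i f).
Proof.
move=> neq; rewrite /top_part dM [X in _ = X * _ + _](_ : _ = 0).
  by rewrite mul0r add0r dXn_neq // iterd_comm.
by rewrite dM d_sign raddfN d_natr oppr0 mulr0 mul0r addr0.
Qed.

(** * Iterated derivatives and the composite of the Phi_i *)

Definition dpow (t : seq 'I_n) (a : R) : R :=
  foldr (fun i => iter p.-1 (d i)) a t.

Fact dpow_is_additive t : zmod_morphism (dpow t).
Proof. by move=> f g; elim: t => //= i t ->; rewrite raddfB. Qed.
HB.instance Definition _ t :=
  GRing.isZmodMorphism.Build R R (dpow t) (dpow_is_additive t).

Lemma dpow_comm (phi : R -> R) t a :
  (forall j f, j \in t -> phi (d j f) = d j (phi f)) ->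
  dpow t (phi a) = phi (dpow t a).
Proof.
elim: t => //= j t IH phiC; rewrite IH => [|k f kt]; last first.
  by rewrite phiC // inE kt orbT.
by elim: p.-1 => //= k ->; rewrite phiC ?mem_head.
Qed.

(** [d j] commutes past the other factors until it meets d_j^(p-1) and completes it to d_j^p = 0. *)
Lemma dpow_d t j a : j \in t -> dpow t (d j a) = 0.
Proof.
elim: t => //= i t IH; rewrite inE => /orP[/eqP->|/IH ->]; last by rewrite raddf0.
rewrite (dpow_comm _ (phi := d i)) => [|k f _]; last exact: d_comm.
by rewrite -iterSr prednK ?d_p // ltnW.
Qed.

Definition iter_defect (A : {set 'I_n}) : R -> seq 'I_n -> R :=
  foldl (fun a i => htpy_defect i (prim i) A a).

(** The induction maintains the vanishing of the derivatives still to come. For [i] in [A], Phi_i is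
    [top_part i], which supplies the factor d_i^(p-1); otherwise it is 1 - T_i d_i. Both commute
    with the remaining d_j, as [s] has no repetitions. *)
Lemma iter_defect_eq0 (A : {set 'I_n}) s a :
  uniq s -> dpow [seq i <- s | i \in A] a = 0 -> iter_defect A a s = 0.
Proof.
rewrite /iter_defect.
elim: s a => //= i s IH a /andP[is_s uniq_s]; rewrite /htpy_defect.
have neq j : j \in [seq i <- s | i \in A] -> j != i.
  by rewrite mem_filter => /andP[_ js]; apply: contraNneq is_s => <-.
case: ifP => iA /= ka0; apply: IH => //.
  rewrite d_prim opprB addrCA subrr addr0.
  have topC j f : j \in [seq k <- s | k \in A] ->
      top_part i (d j f) = d j (top_part i f).
    by move=> jt; rewrite top_part_comm ?neq.
  by rewrite (dpow_comm _ topC) /top_part ka0 !mulr0.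
rewrite (dpow_comm _ (phi := fun a => a - prim i (d i a))) ?ka0 ?raddf0 ?addr0 //.
by move=> j f jt; rewrite raddfB /= d_comm prim_comm ?neq.
Qed.

Definition iter_defect_form (g : form) s : form :=
  [ffun A : {set 'I_n} => iter_defect A (g A) s].

(** For closed g the homotopy identity reads g - Phi_i g = d H_i g, so Phi_i g is closed again and
    the primitives add up. *)
Lemma dR_exact_iter_defect_form g s :
  dR g = 0 -> exists h, g - iter_defect_form g s = dR h.
Proof.
elim: s g => [|i s IH] g dg.
  by exists 0; rewrite raddf0; apply/ffunP => A; rewrite !ffunE /= subrr.
have := htpyP (T := prim i) (fun j f => @prim_comm i j f) g.
set g' := [ffun A => _] => def_g'.
have h0 : htpy i (prim i) 0 = 0.
  by apply/ffunP => A; rewrite !ffunE raddf0 mulr0; case: ifP.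
rewrite dg h0 addr0 in def_g'.
have dg' : dR g' = 0.
  by rewrite -[g'](subKr g) -def_g' raddfB /= dg dR_dR subrr.
have [h eq_h] := IH _ dg'.
exists (htpy i (prim i) g + h); rewrite raddfD /= def_g' -eq_h addrA subrK.
by congr (_ - _); apply/ffunP => A; rewrite !ffunE.
Qed.

Lemma dR_exact g : dR g = 0 -> (forall A, pd_pow d p A (g A) = 0) ->
  exists h, g = dR h.
Proof.
move=> /(@dR_exact_iter_defect_form g (enum 'I_n)) [h eq_h] pd0; exists h.
rewrite -eq_h [iter_defect_form _ _](_ : _ = 0) ?subr0 //.
apply/ffunP => A; rewrite !ffunE; apply: iter_defect_eq0; first exact: enum_uniq.
(* [enum A] is by definition the list of all indices filtered by [A]. *)
by rewrite enumT; apply: pd0.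
Qed.

(** * Transfer to forms of a fixed degree *)

Definition restr r (g : form) : dform n R r := [ffun I => g (val I)].

Definition extend r (w : dform n R r) : form :=
  [ffun A : {set 'I_n} => oapp w 0 (insub A)].

Lemma extendK r : cancel (@extend r) (@restr r).
Proof. by move=> w; apply/ffunP => I; rewrite !ffunE valK. Qed.

Lemma extend_out r (w : dform n R r) (A : {set 'I_n}) :
  #|A| != r -> extend w A = 0.
Proof. by move=> neq; rewrite ffunE insubN. Qed.

Lemma ext_d_restr r (g : form) : ext_d d (restr r g) = restr r.+1 (dR g).
Proof.
apply/ffunP => J; rewrite /ext_d exchange_big sum_ffunE !ffunE [RHS]big_mkcond.
apply: eq_bigr => j _; rewrite sum_ffunE.
case: ifPn => jJ; last first.
  rewrite big1 // => I _; rewrite !ffunE /dz_wedge ifF ?scaler0 //.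
  by apply: contraNF jJ => /andP[_ /eqP ->]; rewrite setU11.
have cardJ : #|val J :\ j| == r.
  by have := valP J; rewrite (cardsD1 j) jJ.
(* For given [j], only this index yields dz_J after wedging with dz_j. *)
pose I0 : mindex n r := Sub (val J :\ j) cardJ.
rewrite (bigD1 I0) //= big1 ?addr0 => [|I neqI].
  by rewrite !ffunE /= !inE eqxx /= setD1K // eqxx -[sgn _ _]sgn_id mulrC.
rewrite !ffunE ifF ?scaler0 //; apply: contraNF neqI => /andP[jI /eqP eqJ].
by apply/eqP/val_inj; rewrite /= eqJ setU1K.
Qed.

Lemma ext_dE r (w : dform n R r) : ext_d d w = restr r.+1 (dR (extend w)).
Proof. by rewrite -ext_d_restr extendK. Qed.

Lemma dR_extend r (w : dform n R r) : ext_d d w = 0 -> dR (extend w) = 0.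
Proof.
rewrite ext_dE => w0; apply/ffunP => A; rewrite [RHS]ffunE.
have [cardA|neqA] := boolP (#|A| == r.+1).
  by have /ffunP/(_ (Sub A cardA)) := w0; rewrite !ffunE.
rewrite ffunE big1 // => j jA; rewrite extend_out ?raddf0 ?mulr0 //.
by apply: contraNneq neqA => <-; rewrite (cardsD1 j A) jA.
Qed.

Lemma exact_p_closed (K : comNzRingType) (iota : K -> R) r (w : dform n R r) :
  exact_form iota d w <-> p_closed iota d p w.
Proof.
(* In degree 0 both sides are [is_const]. *)
case: r w => [//|r] w; split=> [[eta ->]|[dw pw]].
  split=> [|I].
    by rewrite (ext_dE eta) ext_d_restr dR_dR; apply/ffunP => I; rewrite !ffunE.
  (* Each summand of the coefficient at [I] is a derivative d_j with j in [I], killed by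
     d_I^(p-1). *)
  rewrite ext_dE !ffunE [LHS](raddf_sum (dpow (enum (val I)))) big1 //= => j jI.
  by rewrite [LHS](signM_additive (dpow (enum (val I)))) /= dpow_d ?mulr0 ?mem_enum.
have pw' A : pd_pow d p A (extend w A) = 0.
  have [cardA|neqA] := boolP (#|A| == r.+1).
    by rewrite -(pw (Sub A cardA)) ffunE insubT.
  by rewrite extend_out // -[RHS](raddf0 (dpow (enum A))).
have [h eq_h] := dR_exact (dR_extend dw) pw'.
by exists (restr r h); rewrite ext_d_restr -eq_h extendK.
Qed.

End DeRham.

(** * Polynomials and rational functions as instances *)

Section Polynomials.
Variables (K : fieldType) (p : nat) (hp : p \in [pchar K]) (n : nat).
Local Notation P := {mpoly K[n]}.
Local Notation F := (ratfun n K).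

(** On a monomial of exponent m the p-th derivative produces the falling factorial [m i ^_ p], a
    multiple of p!. *)
Lemma iter_mderiv_p (i : 'I_n) (f : P) : iter p (mderiv i) f = 0.
Proof.
rewrite -mderivn_iter mderivnE big1 // => m _.
suff -> : (m i ^_ p)%:R = 0 :> K by rewrite mul0r scale0r.
rewrite -bin_ffact natrM -(prednK (prime_gt0 (pcharf_prime hp))) factS prednK.
  by rewrite natrM (pcharf0 hp) mul0r mulr0.
exact: prime_gt0 (pcharf_prime hp).
Qed.

Fact fderiv_is_additive i : zmod_morphism (@fderiv n K i).
Proof.
have [fD fM fC] := @fderiv_Kderivation n K i => f g.
have f0 : fderiv i (0 : F) = 0.
  by have /eqP := fD 0 0; rewrite addr0 -subr_eq subrr eq_sym => /eqP.
have /eqP := fD (- g) g; rewrite addNr f0 eq_sym addr_eq0 => /eqP fN.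
by rewrite fD fN.
Qed.
HB.instance Definition _ i :=
  GRing.isZmodMorphism.Build F F (@fderiv n K i) (fderiv_is_additive i).

Lemma pchar_mpoly : p \in [pchar P].
Proof. exact: (rmorph_pchar (@mpolyC n K) hp). Qed.

Lemma pchar_ratfun : p \in [pchar F].
Proof. exact: (rmorph_pchar (@tofrac P) pchar_mpoly). Qed.

Lemma fderivM i (f g : F) : fderiv i (f * g) = fderiv i f * g + f * fderiv i g.
Proof. by have [_ -> _] := @fderiv_Kderivation n K i; rewrite [g *: _]mulrC. Qed.

Lemma fderivXp i (f : F) : fderiv i (f ^+ p) = 0.
Proof.
have fderivX k : fderiv i (f ^+ k) = k%:R * (f ^+ k.-1 * fderiv i f).
  elim: k => [|k IH].
    by rewrite expr0 mul0r -tofrac1 fderiv_tofrac -mpolyC1 mderivC tofrac0.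
  rewrite exprS fderivM IH -natr1 mulrDl mul1r addrC; congr (_ + _).
    by case: k {IH} => [|k]; rewrite ?mul0r ?mulr0 // mulrCA [f * _]mulrA -exprS.
  exact: mulrC.
by rewrite fderivX (pcharf0 pchar_ratfun) mul0r.
Qed.

(* f = a / b = b ^- p * (a * b ^ (p - 1)), and b ^- p is a constant. *)
Lemma ratfun_const_mul_mpoly (f : F) : exists c (a : P),
  f = c * tofrac a /\ forall i g, fderiv i (c * g) = c * fderiv i g.
Proof.
have b0 : tofrac \d_(repr f) != 0 :> F by rewrite tofrac_eq0 denom_ratioP.
set b := tofrac _ in b0.
exists (b ^- p), (\n_(repr f) * \d_(repr f) ^+ p.-1); split=> [|i g].
  rewrite {1}(ratfun_repr f) tofracM tofracXn -/b mulrCA; congr (_ * _).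
  rewrite -{1}(prednK (prime_gt0 (pcharf_prime hp))) exprS invfM -mulrA.
  by rewrite mulVf ?mulr1 // expf_neq0.
by rewrite fderivM -exprVn fderivXp mul0r add0r.
Qed.

(** The constant factor [c] passes through both derivations, leaving the polynomial case. *)
Lemma fderiv_comm i j (f : F) : fderiv i (fderiv j f) = fderiv j (fderiv i f).
Proof.
have [c [a [-> cC]]] := ratfun_const_mul_mpoly f.
by rewrite !cC !fderiv_tofrac mderiv_comm.
Qed.

Lemma iter_fderiv_p i (f : F) : iter p (fderiv i) f = 0.
Proof.
have [c [a [-> cC]]] := ratfun_const_mul_mpoly f.
suff -> : forall k,
    iter k (fderiv i) (c * tofrac a) = c * tofrac (iter k (mderiv i) a).
  by rewrite iter_mderiv_p tofrac0 mulr0.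
by elim=> // k IH; rewrite !iterS IH cC fderiv_tofrac.
Qed.

End Polynomials.

Theorem theorem1 (K : fieldType) (p : nat) (hp : p \in [pchar K])
    (n r : nat) :
  (forall w : dform n {mpoly K[n]} r,
     exact_form (@mpolyC n K) (@mderiv n K) w <->
     p_closed (@mpolyC n K) (@mderiv n K) p w) /\
  (forall w : dform n (ratfun n K) r,
     exact_form (@ratfunC n K) (@fderiv n K) w <->
     p_closed (@ratfunC n K) (@fderiv n K) p w).
Proof.
split=> w.
  apply: (@exact_p_closed _ _ (fun i => mderiv i : {additive _ -> _}) _ p
    (fun i => 'X_i)).
  - by move=> i j f; exact: mderiv_comm.
  - exact: pchar_mpoly.
  - by move=> i f g; exact: mderivM.
  - by move=> i j; exact: mderivXi.
  - by move=> i f; exact: iter_mderiv_p.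
apply: (@exact_p_closed _ _ (fun i => @fderiv n K i : {additive _ -> _}) _ p
  (fun i => tofrac 'X_i)).
- by move=> i j f; exact: (fderiv_comm hp).
- exact: pchar_ratfun.
- by move=> i f g; exact: fderivM.
- move=> i j; rewrite /= [LHS]fderiv_tofrac mderivXi.
  by case: eqP; rewrite ?tofrac1 ?tofrac0.
- by move=> i f; exact: iter_fderiv_p.
Qed.
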